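(* Let $D=((l_i,b_i,v_i,\epsilon_i,k_i,\mu_i,m_i))_{i=1}^\infty$ be an APBFF and let $X=(X_i)_{i=1}^\infty$ be a $D$-good sequence of type I (resp. type II). Then $$\eta(D,X)\in\bigcap_{k\in R(D)}\bigcap_{m\in S(D)}\mathscr{N}^{I}_{k,m}(\Gamma(D,X))\quad\Bigl(\text{resp. }\ \eta(D,X)\in\bigcap_{k\in R(D)}\bigcap_{m\in S(D)}\mathscr{N}^{II}_{k,m}(\Gamma(D,X))\Bigr).$$ If moreover $k_i\to\infty$ and $m_i\to\infty$, then $\eta(D,X)\in\mathscr{N}^{I}(\Gamma(D,X))$ (resp. $\eta(D,X)\in\mathscr{N}^{II}(\Gamma(D,X))$).
   Context: $\mathbb{N}=\{1,2,\dots\}$, $\mathbb{N}_0=\{0,1,2,\dots\}$. A block is a finite tuple of non-negative integers, $|B|$ is its length; a block in base $b$ has entries in $\{0,\dots,b-1\}$. Cantor series. A basic sequence is a sequence $Q=(q_n)_{n\ge1}$ of integers $q_n\ge2$. Each real $x$ has a unique $Q$-Cantor series expansion $x=E_0+\sum_{n\ge1}\frac{E_n}{q_1\cdots q_n}$ with $E_0=\lfloor x\rfloor$, $E_n\in\{0,\dots,q_n-1\}$ and $E_n\ne q_n-1$ infinitely often; we write $x=E_0.E_1E_2\dots$ w.r.t. $Q$. For a block $B$ of length $k$, $N_n^Q(B,x)$ is the number of $p$ with $1\le p\le n$ and $(E_p,\dots,E_{p+k-1})=B$. Put $Q_n^{(k)}=\sum_{j=1}^n\frac1{q_jq_{j+1}\cdots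 q_{j+k-1}}$, and let $\mathscr{N}_k(Q)$ be the set of real $x$ with $\lim_n N_n^Q(B,x)/Q_n^{(k)}=1$ for all blocks $B$ of length $k$. Type I. For $m\ge1$, $0\le r\le m-1$: $N^Q_{n,m,r}(B,x)$ is the number of occurrences of $B$ at positions $p$ with $1\le p\le n$, $p\equiv r\pmod m$, and $Q^{(k)}_{n,m,r}=\sum_{1\le p\le n,\ p\equiv r\ (m)}\frac1{q_pq_{p+1}\cdots q_{p+k-1}}$. $\mathscr{N}^I_{k,m,r}(Q)$ is the set of real $x$ with $\lim_n N^Q_{n,m,r}(B,x)/Q^{(k)}_{n,m,r}=1$ for all blocks $B$ of length $k$; $\mathscr{N}^I_{k,m}(Q)=\bigcap_{r=0}^{m-1}\mathscr{N}^I_{k,m,r}(Q)$; $\mathscr{N}^I_k(Q)=\bigcap_{m=1}^k\mathscr{N}^I_{k,m}(Q)$; $\mathscr{N}^I(Q)=\bigcap_{k\ge1}\mathscr{N}^I_k(Q)$. Type II. Let $p_1<p_2<\cdots$ be the positive integers congruent to $r$ mod $m$. Put $\Lambda_{m,r}(Q)=(q_{p_1},q_{p_2},\dots)$ and, for $x=E_0.E_1E_2\dots$ w.r.t. $Q$, $\Upsilon_{Q,m,r}(x)=0.E_{p_1}E_{p_2}\dots$ w.r.t. $\Lambda_{m,r}(Q)$. Then $\mathscr{N}^{II}_{k,m,r}(Q)=\{x:\Upsilon_{Q,m,r}(x)\in\mathscr{N}_k(\Lambda_{m,r}(Q))\}$, $\mathscr{N}^{II}_{k,m}(Q)=\bigcap_{r=0}^{m-1}\mathscr{N}^{II}_{k,m,r}(Q)$,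 $\mathscr{N}^{II}(Q)=\bigcap_{k\ge1}\bigcap_{m\ge1}\mathscr{N}^{II}_{k,m}(Q)$. Measures. For a Borel probability measure $\mu$ on $\mathbb{N}_0^{\mathbb{N}}$ and a block $B=(b_1,\dots,b_k)$, $\mu(B)$ is the measure of the cylinder $\{\omega:\omega_j=b_j,\ 1\le j\le k\}$. $\mu$ is $(v,b)$-uniform ($v\le b$) if $\mu(B)=b^{-k}$ for all $k$ and all blocks $B$ of length $k$ in base $v$. A BFF is a sequence $((l_i,b_i,v_i,\epsilon_i,k_i,\mu_i))_{i\ge1}$ where $(l_i),(b_i),(v_i),(k_i)$ are non-decreasing sequences of non-negative integers with $b_i\ge2$, $b_i\to\infty$, $v_i\to\infty$, each $\mu_i$ is a $(v_i,b_i)$-uniform Borel probability measure on $\mathbb{N}_0^{\mathbb{N}}$, and $(\epsilon_i)$ strictly decreases to $0$. An APBFF is a sequence $D=((l_i,b_i,v_i,\epsilon_i,k_i,\mu_i,m_i))_{i\ge1}$ such that $((l_i,b_i,v_i,\epsilon_i,k_i,\mu_i))_{i\ge1}$ is a BFF and $(m_i)$ is a non-decreasing sequence of integers. Put $R(D)=[1,\lim_i k_i]\cap\mathbb{N}$, $S(D)=[1,\lim_i m_i]\cap\mathbb{N}$. For finite blocks $B,Y$: $N_{|Y|,m,r}(B,Y)$ is the number of occurrences of $B$ in $Y$ starting at positions congruent to $r$ mod $m$; $N'_{|Y|,m,r}(B,Y)$ is the number of occurrences of $B$ in the block formed by the entries of $Y$ at positions congruent to $r$ mod $m$. $Y$ is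 $(\epsilon,k,m,\mu)$-normal of type I (resp. type II) if for all blocks $B$ of length $k'\le k$, all $m'\le m$ and all $0<r\le m'$, $N_{|Y|,m',r}(B,Y)$ (resp. $N'_{|Y|,m',r}(B,Y)$) lies in $\left[\mu(B)\lceil\frac{|Y|-r}{m'}\rceil(1-\epsilon),\ \mu(B)\lceil\frac{|Y|-r}{m'}\rceil(1+\epsilon)\right]$. A sequence of blocks $(X_i)$, with $X_i$ having entries that are digits in base $b_i$, is $D$-good of type I (resp. type II) if $|X_i|$ is non-decreasing, each $X_i$ is $(\epsilon_i,k_i,m_i,\mu_i)$-normal of type I (resp. type II), and for all $k\in R(D)$, as $i\to\infty$: $\frac{b_i^k}{\epsilon_{i-1}-\epsilon_i}=o(|X_i|)$; $\frac{l_{i-1}}{l_i}\cdot\frac{|X_{i-1}|}{|X_i|}=o(i^{-1}b_i^{-k})$; $\frac1{l_i}\cdot\frac{|X_{i+1}|}{|X_i|}=o(b_i^{-k})$. Let $L_0=0$, $L_i=l_1|X_1|+\dots+l_i|X_i|$. $\Gamma(D,X)=(\gamma_n)_{n\ge1}$ with $\gamma_n=b_i$ for $L_{i-1}<n\le L_i$, and $\eta(D,X)=\sum_{n\ge1}\frac{E_n}{\gamma_1\cdots\gamma_n}$ where $(E_1,E_2,\dots)=X_1^{l_1}X_2^{l_2}X_3^{l_3}\cdots$ ($X_i$ repeated $l_i$ times, concatenated). *)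

(* Defs.v *)
From HB Require Import structures.
From mathcomp Require Import all_boot all_order all_algebra.
From mathcomp Require Import all_classical all_reals all_analysis.

Set Implicit Arguments.
Unset Strict Implicit.
Unset Printing Implicit Defensive.

Import Order.TTheory GRing.Theory Num.Theory.
Import numFieldNormedType.Exports.

Local Open Scope classical_set_scope.
Local Open Scope ring_scope.

(* A sequence (x_n)_{n >= 1} is a function on nat whose value at 0 is junk;
   positions in a finite block are also counted from 1, hence the p.-1 in the
   nth and drop below. *)

Section CantorSeries.
Context {R : realType}.
Implicit Types (Q E : nat -> nat) (B : seq nat) (x : R) (k m n r : nat).

Definition cantor_series Q E : R :=
  limn (fun N => \sum_(1 <= n < N.+1)
    ((E n)%:R / \prod_(1 <= j < n.+1) (Q j)%:R) : R).

Definition cantor_expansion Q x E : Prop :=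
  [/\ forall n, (1 <= n)%N -> (E n < Q n)%N,
      forall N, exists2 n, (N <= n)%N & E n <> (Q n).-1
    & x = (Num.floor x)%:~R + cantor_series Q E].

(* For q_n >= 2 the expansion exists and its values at n >= 1 are unique. *)
Definition cantor_digits Q x : nat -> nat :=
  xget (fun=> 0%N) [set E | cantor_expansion Q x E].

Definition occurs_at E B p : bool := [seq E j | j <- iota p (size B)] == B.

Definition occ Q n B x : nat :=
  count (occurs_at (cantor_digits Q x) B) (iota 1 n).

Definition expected Q k n : R :=
  \sum_(1 <= j < n.+1) (\prod_(j <= i < j + k) (Q i)%:R)^-1.

Definition normal_order Q k : set R :=
  [set x | forall B, size B = k ->
     (occ Q n B x)%:R / expected Q k n @[n --> \oo] --> (1 : R)].

Definition occ_ap Q n m r B x : nat :=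
  count (fun p => (p == r %[mod m]) && occurs_at (cantor_digits Q x) B p)
        (iota 1 n).

Definition expected_ap Q k n m r : R :=
  \sum_(1 <= p < n.+1 | p == r %[mod m]) (\prod_(p <= i < p + k) (Q i)%:R)^-1.

Definition normalI_kmr Q k m r : set R :=
  [set x | forall B, size B = k ->
     (occ_ap Q n m r B x)%:R / expected_ap Q k n m r @[n --> \oo] --> (1 : R)].

Definition normalI_km Q k m : set R :=
  \bigcap_(r in `I_m) normalI_kmr Q k m r.

Definition normalI_k Q k : set R :=
  \bigcap_(m in [set m | (1 <= m <= k)%N]) normalI_km Q k m.

Definition normalI Q : set R :=
  \bigcap_(k in [set k | (1 <= k)%N]) normalI_k Q k.

(* For 0 <= r < m, the j-th (j >= 1) positive integer congruent to r mod m. *)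
Definition ap_index m r j : nat := (j.-1 * m + (if r == 0 then m else r))%N.

Definition Lambda Q m r : nat -> nat := Q \o ap_index m r.

Definition Upsilon Q m r x : R :=
  cantor_series (Lambda Q m r) (cantor_digits Q x \o ap_index m r).

Definition normalII_kmr Q k m r : set R :=
  [set x | normal_order (Lambda Q m r) k (Upsilon Q m r x)].

Definition normalII_km Q k m : set R :=
  \bigcap_(r in `I_m) normalII_kmr Q k m r.

Definition normalII Q : set R :=
  \bigcap_(k in [set k | (1 <= k)%N]) \bigcap_(m in [set m | (1 <= m)%N])
    normalII_km Q k m.

End CantorSeries.

(* The product space N_0^N with its Borel sigma-algebra (each factor nat is
   discrete); coordinates are numbered from 0. *)
Definition nat_seq_borel :=
  g_sigma_algebraType (@open (prod_topology (fun _ : nat => nat))).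

Section Blocks.
Context {R : realType}.
Implicit Types (mu : probability nat_seq_borel R) (B Y : seq nat).

Definition cylinder B : set nat_seq_borel :=
  [set w : nat -> nat | forall j, (j < size B)%N -> w j = nth 0%N B j].

Definition block_measure mu B : R := fine (mu (cylinder B)).

Definition uniform_measure (v b : nat) mu : Prop :=
  (v <= b)%N /\
  forall B, all (fun d => d < v)%N B ->
    block_measure mu B = (b%:R ^+ size B)^-1.

Definition occurs_in Y B p : bool := take (size B) (drop p.-1 Y) == B.

Definition block_occ_ap m r B Y : nat :=
  count (fun p => (p == r %[mod m]) && occurs_in Y B p) (iota 1 (size Y)).

Definition ap_subblock m r Y : seq nat :=
  [seq nth 0%N Y p.-1 | p <- iota 1 (size Y) & p == r %[mod m]].

Definition block_occ_sub m r B Y : nat :=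
  let Z := ap_subblock m r Y in count (occurs_in Z B) (iota 1 (size Z)).

(* The condition on B ranges over non-empty blocks; r = m' stands for the
   residue 0. For small Y the integer c may be 0 or negative. *)
Definition block_normal (N : nat -> nat -> seq nat -> seq nat -> nat)
    (eps : R) (k : nat) (m : int) mu Y : Prop :=
  forall B (m' r : nat), (1 <= size B <= k)%N -> m'%:Z <= m ->
    (0 < r <= m')%N ->
    let c : R := (Num.ceil (((size Y)%:R - r%:R) / m'%:R : R))%:~R in
    block_measure mu B * c * (1 - eps) <= (N m' r B Y)%:R
      <= block_measure mu B * c * (1 + eps).

Definition block_normalI := block_normal block_occ_ap.
Definition block_normalII := block_normal block_occ_sub.

End Blocks.

Definition nondecreasing_from1 {d} {T : porderType d} (u : nat -> T) : Prop :=
  forall i, (1 <= i)%N -> (u i <= u i.+1)%O.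

Record bff (R : realType) := Bff {
  l_ : nat -> nat;
  b_ : nat -> nat;
  v_ : nat -> nat;
  eps_ : nat -> R;
  k_ : nat -> nat;
  mu_ : nat -> probability nat_seq_borel R;
  l_ndecr : nondecreasing_from1 l_;
  b_ndecr : nondecreasing_from1 b_;
  v_ndecr : nondecreasing_from1 v_;
  k_ndecr : nondecreasing_from1 k_;
  b_ge2 : forall i, (1 <= i)%N -> (2 <= b_ i)%N;
  b_infty : b_ @ \oo --> \oo;
  v_infty : v_ @ \oo --> \oo;
  mu_uniform : forall i, (1 <= i)%N -> uniform_measure (v_ i) (b_ i) (mu_ i);
  eps_decr : forall i, (1 <= i)%N -> eps_ i.+1 < eps_ i;
  eps_cvg0 : eps_ @ \oo --> (0 : R)
}.

Record apbff (R : realType) := Apbff {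
  apbff_bff :> bff R;
  m_ : nat -> int;
  m_ndecr : nondecreasing_from1 m_
}.

Section Construction.
Context {R : realType}.
Implicit Types (D : apbff R) (X : nat -> seq nat).

Definition RD D : set nat :=
  [set k | (1 <= k)%N /\
           (k%:R%:E <= limn (fun i => (k_ D i)%:R%:E : \bar R))%E].

Definition SD D : set nat :=
  [set m | (1 <= m)%N /\
           (m%:R%:E <= limn (fun i => (m_ D i)%:~R%:E : \bar R))%E].

(* The first conjunct of good_growth makes the quotients by l_i meaningful:
   BFFs allow l_i = 0, and x / 0 = 0 in the library. *)
Definition good_growth D X : Prop :=
  let len i : R := (size (X i))%:R in
  let l i : R := (l_ D i)%:R in
  let b i : R := (b_ D i)%:R in
  (\forall i \near \oo, (0 < l_ D i)%N) /\
  forall k, RD D k ->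
  [/\ (fun i => b i ^+ k / (eps_ D i.-1 - eps_ D i)) =o_\oo len,
      (fun i => l i.-1 / l i * (len i.-1 / len i))
        =o_\oo (fun i => i%:R^-1 * (b i ^+ k)^-1)
    & (fun i => (l i)^-1 * (len i.+1 / len i))
        =o_\oo (fun i => (b i ^+ k)^-1)].

Definition good
    (normal : R -> nat -> int -> probability nat_seq_borel R -> seq nat -> Prop)
    D X : Prop :=
  [/\ forall i, (1 <= i)%N -> all (fun d => d < b_ D i)%N (X i),
      nondecreasing_from1 (fun i => size (X i)),
      forall i, (1 <= i)%N ->
        normal (eps_ D i) (k_ D i) (m_ D i) (mu_ D i) (X i)
    & good_growth D X].

Definition goodI := good block_normalI.
Definition goodII := good block_normalII.

Definition L D X (i : nat) : nat :=
  (\sum_(1 <= j < i.+1) l_ D j * size (X j))%N.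

(* The i >= 1 with L_{i-1} < n <= L_i; for a good X with R(D) non-empty it
   exists and is unique for every n >= 1. *)
Definition level D X (n : nat) : nat :=
  xget 0%N [set i | (1 <= i)%N /\ (L D X i.-1 < n <= L D X i)%N].

Definition Gamma D X (n : nat) : nat := b_ D (level D X n).

Definition concat D X (i : nat) : seq nat :=
  flatten [seq flatten (nseq (l_ D j) (X j)) | j <- iota 1 i].

(* The n-th letter of X_1^{l_1} X_2^{l_2} ... is read off the prefix
   X_1^{l_1} ... X_i^{l_i}, of length L_i >= n, where i = level n. *)
Definition digit D X (n : nat) : nat :=
  nth 0%N (concat D X (level D X n)) n.-1.

Definition eta D X : R := cantor_series (Gamma D X) (digit D X).

End Construction.

(* Main.v *)
Require Import Defs.
From mathcomp Require Import all_boot all_order all_algebra.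
From mathcomp Require Import all_classical all_reals all_analysis.
From mathcomp Require Import zify ring lra.
Import Order.TTheory GRing.Theory Num.Theory.
Import numFieldNormedType.Exports.
Local Open Scope classical_set_scope.
Local Open Scope ring_scope.
Set Implicit Arguments.
Unset Strict Implicit.
Unset Printing Implicit Defensive.

(** The digit sequence is cut into copies of the blocks [X i]. Fix an order [k],
    a modulus [m] and a residue class, and put
    [g i = b_i ^ - k * (|X_i| / m)]. One copy of [X i] contains [g i * (1 + o(1))]
    occurrences of any given block of length [k] at the positions in the class:
    normality of [X i] counts those inside the copy with relative error
    [eps_i -> 0], and the boundedly many that run over its end are negligible
    because [b_i ^ k = o(|X_i|)] makes [g i] tend to infinity. The same copy
    contributes [g i * (1 + o(1))] to the normalising sum, since all its
    summands are [b_i ^ - k] except boundedly many smaller ones near its end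
    ([copy_estimates]). Hence the two sums are asymptotic along ends of copies.
    An unfinished copy of [X i.+1] changes either sum by at most [|X_{i+1}|],
    which is [o(l_i * g i)], that is, negligible against the preceding level
    alone ([block_sums_ratio_cvg1]). So the quotient tends to 1.

    Types I and II are treated together. An occurrence of a block in the
    subsequence of the positions congruent to [r] modulo [m] is an occurrence in
    the full sequence whose letters are [m] apart; so both types count, in a
    residue class, occurrences with some step [d] ([occurs_step]), with [d = 1]
    for type I and [d = m] for type II.

    It remains to know that the sequence that defines [eta], and for type II
    each of its subsequences, consists of the digits of the Cantor series
    expansion of its sum. Expansions that do not end in maximal digits are
    unique ([cantor_digits_series]), and the digit 0, which is not maximal,
    recurs in every residue class because the block of [k] zeros does
    ([digit_zero_infinitely_often]). *)

(** * Cantor series expansions *)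

Section CantorExpansions.
Context {R : realType}.
Implicit Types (Q E : nat -> nat).

Definition cantor_partial Q E (N : nat) : R :=
  \sum_(1 <= n < N.+1) ((E n)%:R / \prod_(1 <= j < n.+1) (Q j)%:R).

Definition is_digits Q E := forall n, (1 <= n)%N -> (E n < Q n)%N.

Lemma is_digits_shift Q E :
  is_digits Q E -> is_digits (Q \o succn) (E \o succn).
Proof. by move=> dE n _; exact: dE. Qed.

Lemma is_digits_base_gt0 Q E : is_digits Q E -> 0 < (Q 1%N)%:R :> R.
Proof. by move=> /(_ 1%N isT) dE; rewrite ltr0n (leq_trans _ dE). Qed.

Lemma cantor_partial_shift Q E N :
  cantor_partial Q E N.+1 =
  ((E 1%N)%:R + cantor_partial (Q \o succn) (E \o succn) N) / (Q 1%N)%:R.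
Proof.
rewrite /cantor_partial big_ltn // big_nat1 mulrDl; congr (_ + _).
rewrite big_add1 /= mulr_suml; apply: eq_big_nat => n /andP[n0 _].
by rewrite big_ltn // big_add1 /= invfM mulrA mulrAC.
Qed.

Lemma cantor_partial_itv Q E N : is_digits Q E ->
  0 <= cantor_partial Q E N <= 1.
Proof.
elim: N Q E => [|N IH] Q E dE; first by rewrite /cantor_partial big_geq ?lexx ?ler01.
have Q0 := is_digits_base_gt0 dE.
have /andP[s0 s1] := IH _ _ (is_digits_shift dE).
rewrite cantor_partial_shift divr_ge0 ?addr_ge0 ?ler0n //=.
rewrite ler_pdivrMr // mul1r (le_trans (lerD (lexx _) s1)) //.
by rewrite natr1 ler_nat; apply: dE.
Qed.

Lemma cantor_partial_cvg Q E : is_digits Q E ->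
  cantor_partial Q E @ \oo --> cantor_series (R := R) Q E.
Proof.
move=> dE; apply: nondecreasing_is_cvgn.
  apply/nondecreasing_seqP => n; rewrite {2}/cantor_partial big_nat_recr //=.
  by rewrite lerDl divr_ge0 ?prodr_ge0.
by exists 1 => _ [N _ <-]; case/andP: (cantor_partial_itv N dE).
Qed.

Lemma cantor_series_itv Q E : is_digits Q E ->
  0 <= cantor_series (R := R) Q E <= 1.
Proof.
move=> dE; have cv := cantor_partial_cvg dE.
have cE := cvg_lim (@Rhausdorff R) cv.
have cc : cvgn (cantor_partial Q E) by apply/cvg_ex; eexists; exact: cv.
apply/andP; split; rewrite -cE.
  by apply: limr_ge => //; apply: nearW => N; case/andP: (cantor_partial_itv N dE).
by apply: limr_le => //; apply: nearW => N; case/andP: (cantor_partial_itv N dE).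
Qed.

(** The recursion that lets statements on expansions be proved by induction on a
    digit position. *)
Lemma cantor_series_shift Q E : is_digits Q E ->
  cantor_series (R := R) Q E =
  ((E 1%N)%:R + cantor_series (Q \o succn) (E \o succn)) / (Q 1%N)%:R.
Proof.
move=> dE.
have cv : (fun N => cantor_partial Q E N.+1) @ \oo --> cantor_series (R := R) Q E.
  by have := cantor_partial_cvg dE; rewrite -cvg_shiftS.
have cv' := cantor_partial_cvg (is_digits_shift dE).
apply: (cvg_unique _ cv) => //; rewrite /= (eq_cvg _ _ (cantor_partial_shift Q E)).
by apply: cvgMl; apply: cvgD => //; exact: cvg_cst.
Qed.

(** A digit below the maximal one leaves room for the tail after it, which is at
    most 1; the gap survives the digits in front. *)
Lemma cantor_series_lt1 Q E n : is_digits Q E ->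
  (1 <= n)%N -> E n <> (Q n).-1 -> cantor_series (R := R) Q E < 1.
Proof.
case: n => // n; elim: n Q E => [|n IH] Q E dE _ neq;
  have Q0 := is_digits_base_gt0 dE;
  have /andP[_ s1] := cantor_series_itv (is_digits_shift dE);
  rewrite cantor_series_shift // ltr_pdivrMr // mul1r.
  apply: le_lt_trans (lerD (lexx _) s1) _.
  by rewrite natr1 ltr_nat; have := dE 1%N isT; lia.
have {}IH := IH _ _ (is_digits_shift dE) isT neq.
apply: lt_le_trans (_ : (E 1%N)%:R + 1 <= _); first by rewrite ltrD2l.
by rewrite natr1 ler_nat; exact: dE.
Qed.

Definition not_eventually_max Q E :=
  forall N, exists2 n, (N <= n)%N & E n <> (Q n).-1.

Lemma not_eventually_max_shift Q E :
  not_eventually_max Q E -> not_eventually_max (Q \o succn) (E \o succn).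
Proof.
move=> mE N; have [[//|n] Nn En] := mE N.+1.
by exists n.
Qed.

Lemma not_eventually_max_lt1 Q E : is_digits Q E -> not_eventually_max Q E ->
  cantor_series (R := R) Q E < 1.
Proof. by move=> dE /(_ 1%N)[n n1]; exact: cantor_series_lt1. Qed.

(** The first digit is the integer part of [Q 1] times the series, because the
    rest of the series is less than 1. *)
Lemma cantor_series_first_digit Q E E' :
  is_digits Q E -> not_eventually_max Q E ->
  is_digits Q E' -> not_eventually_max Q E' ->
  cantor_series (R := R) Q E = cantor_series Q E' ->
  E 1%N = E' 1%N /\
  cantor_series (R := R) (Q \o succn) (E \o succn) =
  cantor_series (Q \o succn) (E' \o succn).
Proof.
move=> dE mE dE' mE'.
have [dS dS'] := (is_digits_shift dE, is_digits_shift dE').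
rewrite (cantor_series_shift dE) (cantor_series_shift dE').
have /andP[s0 _] := cantor_series_itv dS.
have /andP[s0' _] := cantor_series_itv dS'.
have s1 := not_eventually_max_lt1 dS (not_eventually_max_shift mE).
have s1' := not_eventually_max_lt1 dS' (not_eventually_max_shift mE').
move: (cantor_series _ _) (cantor_series _ _) s0 s0' s1 s1' => t t' t0 t0' t1 t1'.
move/(divIf (lt0r_neq0 (is_digits_base_gt0 dE))) => tt'.
have E1 : E 1%N = E' 1%N.
  have le_lt a b : a%:R < b%:R + 1 :> R -> (a <= b)%N by rewrite natr1 ltr_nat.
  by apply/eqP; rewrite eqn_leq; apply/andP; split; apply: le_lt; lra.
by split=> //; move: tt'; rewrite E1 => /addrI.
Qed.

Lemma cantor_series_inj Q E E' :
  is_digits Q E -> not_eventually_max Q E ->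
  is_digits Q E' -> not_eventually_max Q E' ->
  cantor_series (R := R) Q E = cantor_series Q E' ->
  forall n, (1 <= n)%N -> E n = E' n.
Proof.
move=> dE mE dE' mE' EE' [//|n] _.
elim: n Q E E' dE mE dE' mE' EE' => [|n IH] Q E E' dE mE dE' mE' EE';
  have [E1 ES] := cantor_series_first_digit dE mE dE' mE' EE'; first by [].
by apply: (IH _ _ _ _ _ _ _ ES); [exact: is_digits_shift|
  exact: not_eventually_max_shift|exact: is_digits_shift|
  exact: not_eventually_max_shift].
Qed.

(** Such a series lies in [0, 1), so its integer part does not disturb its digits. *)
Lemma cantor_digits_series Q E : is_digits Q E -> not_eventually_max Q E ->
  forall n, (1 <= n)%N -> cantor_digits Q (cantor_series (R := R) Q E) n = E n.
Proof.
move=> dE mE n n1.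
have /andP[s0 _] := cantor_series_itv dE.
have s1 := not_eventually_max_lt1 dE mE.
have f0 : Num.floor (cantor_series (R := R) Q E) = 0.
  by apply/floor_def; rewrite s0 /=.
rewrite /cantor_digits; case: xgetP => [E' _|/(_ E)].
  case=> dE' mE'; rewrite f0 add0r => EE'.
  by apply: (cantor_series_inj dE' mE' dE mE) => //; rewrite -EE'.
by case; split => //; rewrite f0 add0r.
Qed.

End CantorExpansions.

(** * Occurrences with a step *)

Section Occurrences.
Implicit Types (E Q : nat -> nat) (B Y : seq nat) (d m r p n : nat).

(** With [d = 1] this is an ordinary occurrence; with [d = m] it is an occurrence
    in the subsequence of the positions congruent to [p] modulo [m]. *)
Definition occurs_step d E B p : bool :=
  [seq E (p + j * d)%N | j <- iota 0 (size B)] == B.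

Lemma occurs_stepP d E B p :
  reflect (forall j, (j < size B)%N -> E (p + j * d)%N = nth 0%N B j)
          (occurs_step d E B p).
Proof.
apply: (iffP eqP) => [BE j jB|EB].
  by rewrite -[in RHS]BE (nth_map 0%N) ?size_iota // nth_iota.
apply: (@eq_from_nth _ 0%N); first by rewrite size_map size_iota.
move=> j; rewrite size_map size_iota => jB.
by rewrite (nth_map 0%N) ?size_iota // nth_iota // EB.
Qed.

Lemma occurs_at_step E B p : occurs_at E B p = occurs_step 1 E B p.
Proof.
rewrite /occurs_at /occurs_step; congr (_ == _).
rewrite -[X in iota X _](addn0 p) iotaDl -map_comp.
by apply: eq_map => j /=; rewrite muln1.
Qed.

Definition fits_step d B Y p : bool := (p + (size B).-1 * d <= size Y)%N.

Definition block_occ_step d m r B Y : nat :=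
  count (fun p => [&& p == r %[mod m], fits_step d B Y p
                    & occurs_step d (nth 0%N Y \o predn) B p])
        (iota 1 (size Y)).

Lemma occurs_in_step Y B p : (0 < size B)%N -> (0 < p)%N ->
  occurs_in Y B p =
  fits_step 1 B Y p && occurs_step 1 (nth 0%N Y \o predn) B p.
Proof.
move=> B0 p0; rewrite /occurs_in /fits_step.
apply/eqP/andP => [BE|[fit /occurs_stepP EB]].
  have sB : (p + (size B).-1 * 1 <= size Y)%N.
    have : size (take (size B) (drop p.-1 Y)) = size B by rewrite BE.
    by rewrite size_take size_drop; case: ltnP; lia.
  split=> //; apply/occurs_stepP => j jB /=.
  rewrite -[in RHS]BE nth_take // nth_drop; congr nth; lia.
apply: (@eq_from_nth _ 0%N).
  by rewrite size_take size_drop; case: ifP; lia.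
move=> j; rewrite size_take size_drop => jB.
have {}jB : (j < size B)%N by move: jB; case: ifP; lia.
rewrite -EB // nth_take // nth_drop /=; congr nth; lia.
Qed.

(** The number of terms [r + j * m <= n] with [j : nat], when [0 < r <= m]. *)
Definition ap_count n m r := ((n + m - r) %/ m)%N.

Lemma ltn_ap_count n m r j : (0 < r <= m)%N ->
  (j < ap_count n m r)%N = (r + j * m <= n)%N.
Proof. move=> rm; rewrite /ap_count leq_divRL; last by lia. by nia. Qed.

(** Members of a residue class in increasing order; this turns counts over a class
    into counts over an initial segment of the index of the subsequence. *)
Lemma filter_mod_iota n m r : (0 < r <= m)%N ->
  [seq p <- iota 1 n | p == r %[mod m]] =
  [seq (r + j * m)%N | j <- iota 0 (ap_count n m r)].
Proof.
move=> rm; apply: (irr_sorted_eq ltn_trans ltnn).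
- by apply: sorted_filter (iota_ltn_sorted _ _); exact: ltn_trans.
- rewrite sorted_map; apply: sub_sorted (iota_ltn_sorted _ _) => i j /=.
  by nia.
move=> p; rewrite mem_filter mem_iota; apply/andP/mapP => [[/eqP pr pn]|[j]].
  have rp : (r <= p)%N.
    rewrite leqNgt; apply/negP => pr'.
    move: pr; rewrite modn_small; last by lia.
    have [->|/eqP rm'] := eqVneq r m; first by rewrite modnn; lia.
    by rewrite modn_small; lia.
  have : (m %| p - r)%N by rewrite -eqn_mod_dvd // pr.
  case/dvdnP => j pE; exists j; last by lia.
  by rewrite mem_iota ltn_ap_count //; lia.
rewrite mem_iota ltn_ap_count // => jn ->.
by rewrite addnC modnMDl; split => //; lia.
Qed.

Lemma count_mod_iota (P : pred nat) n m r : (0 < r <= m)%N ->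
  count (fun p => (p == r %[mod m]) && P p) (iota 1 n) =
  count (fun j => P (r + j * m)%N) (iota 0 (ap_count n m r)).
Proof.
move=> rm; rewrite -(count_map (fun j => r + j * m)%N) -filter_mod_iota //.
by rewrite count_filter; apply: eq_count => p /=; rewrite andbC.
Qed.

Lemma block_occ_ap_step m r B Y : (0 < size B)%N ->
  block_occ_ap m r B Y = block_occ_step 1 m r B Y.
Proof.
move=> B0; apply: eq_in_count => p; rewrite mem_iota => /andP[p0 _].
by rewrite occurs_in_step.
Qed.

Lemma size_ap_subblock m r Y : (0 < r <= m)%N ->
  size (ap_subblock m r Y) = ap_count (size Y) m r.
Proof. by move=> rm; rewrite size_map filter_mod_iota // size_map size_iota. Qed.

Lemma nth_ap_subblock m r Y j : (0 < r <= m)%N -> (j < ap_count (size Y) m r)%N ->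
  nth 0%N (ap_subblock m r Y) j = nth 0%N Y (r + j * m).-1.
Proof.
move=> rm jY; rewrite /ap_subblock filter_mod_iota // -map_comp.
by rewrite (nth_map 0%N) ?size_iota // nth_iota.
Qed.

(** Consecutive letters of the subblock at the positions congruent to [r] are
    letters [m] apart in the block itself. *)
Lemma block_occ_sub_step m r B Y : (0 < size B)%N -> (0 < r <= m)%N ->
  block_occ_sub m r B Y = block_occ_step m m r B Y.
Proof.
move=> B0 rm; rewrite /block_occ_sub /block_occ_step count_mod_iota //.
rewrite size_ap_subblock // -[1%N]addn0 iotaDl count_map.
apply: eq_in_count => j; rewrite mem_iota /= => jY.
rewrite occurs_in_step //.
have -> : fits_step 1 B (ap_subblock m r Y) (1 + j) =
          fits_step m B Y (r + j * m).
  rewrite /fits_step size_ap_subblock // muln1 add1n addSn ltn_ap_count //.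
  by rewrite mulnDl addnA.
apply: andb_id2l => fit.
have lt i : (i < size B)%N -> (j + i < ap_count (size Y) m r)%N.
  by move=> iB; rewrite ltn_ap_count //; move: fit; rewrite /fits_step; nia.
have letters i : (i < size B)%N ->
    nth 0%N (ap_subblock m r Y) (1 + j + i * 1).-1 =
    nth 0%N Y (r + j * m + i * m).-1.
  move=> iB; rewrite muln1 add1n addSn /= nth_ap_subblock ?lt //.
  by rewrite mulnDl addnA.
apply/occurs_stepP/occurs_stepP => EB i iB.
  by rewrite -[LHS]letters //; exact: EB.
by rewrite [LHS]letters //; exact: EB.
Qed.

(** Using the representative [m] of the class of 0 removes the case distinction
    in [ap_index]. *)
Lemma ap_indexE m r : (r < m)%N -> exists2 r' : nat, (0 < r' <= m)%N &
  (forall p, (p == r' %[mod m]) = (p == r %[mod m])) /\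
  forall j, (0 < j)%N -> ap_index m r j = (r' + j.-1 * m)%N.
Proof.
move=> rm; exists (if r == 0 then m else r); first by case: eqP; lia.
split=> [p|j j0]; last by rewrite /ap_index addnC.
by have [->|] := eqVneq r 0%N; rewrite ?modnn ?mod0n.
Qed.

End Occurrences.

(** * Asymptotic comparison of two sums over repeated blocks *)

Section AsymptoticRatio.
Context {R : realType}.

Lemma near_infty_ex (P : nat -> Prop) :
  (\forall i \near \oo, P i) -> exists N, forall i, (N <= i)%N -> P i.
Proof. by case=> N _ HN; exists N => i /HN. Qed.

(** Level [i] consists of [l i] copies of length [x i] and ends at [L i]; over each
    copy both [A] and [W] increase by about [g i]. Summing the copies compares
    [A] and [W] at every end of a copy, up to a constant which is absorbed as
    [W] is unbounded. Within a copy of level [i.+1] each sum moves by at most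
    [x i.+1], which is small against the increase [l i * g i] over level [i]. *)
Lemma block_sums_ratio_cvg1 (A W : nat -> R) (x l L : nat -> nat)
    (g : nat -> R) :
  A 0%N = 0 -> W 0%N = 0 ->
  (forall n, 0 <= A n.+1 - A n <= 1) -> (forall n, 0 <= W n.+1 - W n <= 1) ->
  (forall i, L i.+1 = (L i + l i.+1 * x i.+1)%N) ->
  (forall n, exists i, (n <= L i)%N) ->
  (\forall i \near \oo, (0 < l i)%N) ->
  g @ \oo --> +oo ->
  (forall e, 0 < e -> \forall i \near \oo, forall a, (a < l i.+1)%N ->
     let s := (L i + a * x i.+1)%N in
     `|A (s + x i.+1)%N - A s - g i.+1| <= e * g i.+1 /\
     `|W (s + x i.+1)%N - W s - g i.+1| <= e * g i.+1) ->
  (forall e, 0 < e -> \forall i \near \oo, (x i.+1)%:R <= e * ((l i)%:R * g i)) ->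
  A n / W n @[n --> \oo] --> (1 : R).
Proof.
move=> A0 W0 Ainc Winc LS Lub l0 goo AWg xo.
have incP (F : nat -> R) : (forall n, 0 <= F n.+1 - F n <= 1) ->
    forall n j, 0 <= F (n + j)%N - F n <= j%:R.
  move=> Finc n; elim=> [|j /andP[IH1 IH2]]; first by rewrite addn0 subrr lexx.
  have /andP[F1 F2] := Finc (n + j)%N.
  rewrite addnS -natr1; apply/andP; split; lra.
have Winc2 := incP _ Winc; have Ainc2 := incP _ Ainc.
have Wge0 n : 0 <= W n by have := Winc2 0%N n; rewrite add0n W0 subr0 => /andP[].
have Wmono i j : (i <= j)%N -> W i <= W j.
  by move=> /subnKC <-; have /andP[] := Winc2 i (j - i)%N; rewrite subr_ge0.
have Lmono i j : (i <= j)%N -> (L i <= L j)%N.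
  move=> /subnKC <-; elim: (j - i)%N => [|d IH]; first by rewrite addn0.
  by rewrite addnS LS (leq_trans IH) ?leq_addr.
apply/cvgrPdist_le => e e0.
(* The relative errors are 4 * d from the full copies, 2 * d from the unfinished
   copy and d from the initial levels. *)
pose d := Num.min (e / 7) (1 / 4 : R).
have d0 : 0 < d by rewrite lt_min; apply/andP; split; lra.
have de : 7 * d <= e.
  have : d <= e / 7 by rewrite ge_min lexx.
  lra.
have d4 : d <= 1 / 4 by rewrite ge_min lexx orbT.
have /near_infty_ex[N1 l1] := l0.
have /near_infty_ex[N2 g1] : \forall i \near \oo, 1 <= g i.
  by move/cvgryPge : goo; apply.
have /near_infty_ex[N3 {}AWg] := AWg _ d0.
have /near_infty_ex[N4 {}xo] := xo _ d0.
pose i0 := maxn (maxn N1 N2) (maxn N3 N4).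
have {}l1 i : (i0 <= i)%N -> (0 < l i)%N by move=> i0i; apply: l1; lia.
have {}g1 i : (i0 <= i)%N -> 1 <= g i by move=> i0i; apply: g1; lia.
have {}AWg i : (i0 <= i)%N -> forall a, (a < l i.+1)%N ->
     let s := (L i + a * x i.+1)%N in
     `|A (s + x i.+1)%N - A s - g i.+1| <= d * g i.+1 /\
     `|W (s + x i.+1)%N - W s - g i.+1| <= d * g i.+1.
  by move=> i0i; apply: AWg; lia.
have {}xo i : (i0 <= i)%N -> (x i.+1)%:R <= d * ((l i)%:R * g i).
  by move=> i0i; apply: xo; lia.
(* As d <= 1/4, a copy adds at least g/2 to W, while it adds at most 2 * d * g to
   |A - W|. *)
have copies i a : (i0 <= i)%N -> (a <= l i.+1)%N ->
    let s := (L i + a * x i.+1)%N in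
    a%:R * g i.+1 <= 2 * (W s - W (L i)) /\
    `|A s - W s - (A (L i) - W (L i))| <= 4 * d * (W s - W (L i)).
  move=> i0i; have gi : 1 <= g i.+1 by apply: g1; lia.
  elim: a => [|a IH] al /=; first by rewrite mul0n addn0 !subrr normr0 mul0r !mulr0.
  have [IHW IHA] := IH (ltnW al).
  have [HA HW] := AWg _ i0i _ al.
  rewrite mulSn addnCA addnC; set s := (L i + a * x i.+1)%N in IHW IHA HA HW *.
  have dg : d * g i.+1 <= g i.+1 / 4 by nra.
  have W2 : g i.+1 <= 2 * (W (s + x i.+1)%N - W s).
    by move: HW; rewrite ler_norml => /andP[]; lra.
  rewrite -natr1; split; first lra.
  have d2 : 2 * (d * g i.+1) <= 4 * d * (W (s + x i.+1)%N - W s) by nra.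
  move: HA HW IHA; rewrite !ler_norml => /andP[? ?] /andP[? ?] /andP[? ?].
  by apply/andP; split; lra.
pose C := `|A (L i0) - W (L i0)|.
have levels i : (i0 <= i)%N -> `|A (L i) - W (L i)| <= C + 4 * d * W (L i).
  move=> /subnKC <-; elim: (i - i0)%N => [|j IH].
    by rewrite addn0 lerDl mulr_ge0 ?mulr_ge0 // ltW.
  rewrite addnS; have [|_] := copies (i0 + j)%N _ _ (leqnn _); first lia.
  rewrite -LS; move: IH; rewrite !ler_norml => /andP[? ?] /andP[? ?].
  by apply/andP; split; lra.
have Wlevel i : (i0 < i)%N -> (l i)%:R * g i <= 2 * W (L i).
  case: i => // i i0i; have [H _] := copies i _ i0i (leqnn _).
  by move: H; rewrite -LS; have := Wge0 (L i); lra.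
have /near_infty_ex[N5 gC] : \forall i \near \oo, 2 * (C / d) <= g i.
  by move/cvgryPge : goo; apply.
pose i1 := maxn i0.+1 N5.
exists (L i1).+1 => // n /= L1n.
have [i [i1i Lin nLi]] : exists i, [/\ (i1 <= i)%N, (L i < n)%N & (n <= L i.+1)%N].
  have [[|i] nL minL] := ex_minnP (Lub n); first by have := Lmono 0%N i1 isT; lia.
  have Lin : (L i < n)%N by rewrite ltnNge; apply/negP => /minL; rewrite ltnn.
  exists i; split => //; rewrite leqNgt; apply/negP => ii1.
  by have := Lmono _ _ ii1; lia.
have i0i : (i0 < i)%N by lia.
pose a := ((n - L i) %/ x i.+1)%N; pose c := ((n - L i) %% x i.+1)%N.
have nE : n = (L i + a * x i.+1 + c)%N.
  by rewrite -addnA -divn_eq subnKC // ltnW.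
have al : (a <= l i.+1)%N.
  rewrite /a; have [->|x0] := posnP (x i.+1); first by rewrite divn0.
  rewrite -(mulnK (l i.+1) x0); apply: leq_div2r; move: nLi; rewrite LS; lia.
have cx : (c <= x i.+1)%N.
  have [x0|x0] := posnP (x i.+1); last by rewrite ltnW // ltn_mod.
  by move: nLi; rewrite LS /c x0; lia.
have [_ cA] := copies i a (ltnW i0i) al.
move: cA; set s := (L i + a * x i.+1)%N in nE * => cA.
have /andP[A1 A2] := Ainc2 s c; have /andP[W1 W2] := Winc2 s c.
rewrite -nE in A1 A2 W1 W2.
have lev := levels i (ltnW i0i).
have cx' : c%:R <= (x i.+1)%:R :> R by rewrite ler_nat.
have xi := xo i (ltnW i0i).
have Wi := Wlevel i i0i.
have gi : 1 <= g i by exact: g1 _ (ltnW i0i).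
have li : 1 <= (l i)%:R :> R by rewrite ler1n; exact: l1 _ (ltnW i0i).
have gli : g i <= (l i)%:R * g i by rewrite ler_peMl //; lra.
have Wn : W (L i) <= W n by apply/Wmono/ltnW.
have Wn0 : 0 < W n by lra.
have CW : C <= d * W n.
  have := gC _ (leq_trans (leq_maxr _ _) i1i); rewrite -ler_pdivrMl // mulrC; lra.
have dli : d * ((l i)%:R * g i) <= d * (2 * W n) by rewrite ler_pM2l //; lra.
have dWi : d * W (L i) <= d * W n by rewrite ler_pM2l.
have dWs : d * W s <= d * W n by rewrite ler_pM2l //; lra.
have AW : `|W n - A n| <= e * W n.
  have eW : 7 * d * W n <= e * W n by rewrite ler_pM2r.
  move: cA lev; rewrite !ler_norml => /andP[? ?] /andP[? ?].
  by apply/andP; split; lra.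
rewrite -[1](divff (lt0r_neq0 Wn0)) -mulrBl normrM normfV (gtr0_norm Wn0).
by rewrite ler_pdivrMr.
Qed.
End AsymptoticRatio.

(** * Counts and normalising sums *)

Section HitsAndWeights.
Context {R : realType}.
Implicit Types (E Q : nat -> nat) (B Y : seq nat) (d m r p n k s : nat).

Definition hits d m r E B n : nat :=
  count (fun p => (p == r %[mod m]) && occurs_step d E B p) (iota 1 n).

(** For [d = 1] the normalising sum of type I; for [d = m] the one of type II, of
    the subsequence but in terms of the full sequence. *)
Definition weight d m r k Q n : R :=
  \sum_(p <- iota 1 n | p == r %[mod m])
    (\prod_(0 <= j < k) (Q (p + j * d)%N)%:R)^-1.

Lemma eq_hits d m r E E' B n : (forall p, (1 <= p)%N -> E p = E' p) ->
  hits d m r E B n = hits d m r E' B n.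
Proof.
move=> EE'; apply: eq_in_count => p; rewrite mem_iota => /andP[p1 _].
congr (_ && _); apply/occurs_stepP/occurs_stepP => EB j /EB;
  rewrite EE' //; exact: leq_trans p1 (leq_addr _ _).
Qed.

Lemma occ_ap_hits Q n m r B (x : R) :
  occ_ap Q n m r B x = hits 1 m r (cantor_digits Q x) B n.
Proof. by apply: eq_count => p; rewrite occurs_at_step. Qed.

Lemma expected_ap_weight Q k n m r :
  expected_ap Q k n m r = weight 1 m r k Q n.
Proof.
rewrite /expected_ap /weight /index_iota subn1 /=; apply: eq_bigr => p _.
congr (_^-1); rewrite -{1}[p]add0n big_addn addnC addnK.
by apply: eq_bigr => j _; rewrite muln1 addnC.
Qed.

Lemma ap_count_index n m r : (0 < r <= m)%N ->
  ap_count (r + n * m)%N m r = n.+1.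
Proof.
move=> rm; rewrite /ap_count -addnA addKn -mulSnr mulnK //; lia.
Qed.

(** Position [n] of the subsequence is position [ap_index m r n] of the sequence, so
    a count up to [n] in the former is a count up to [ap_index m r n] in the
    latter. *)
Lemma occ_Lambda_hits Q' E n m r B (x : R) : (r < m)%N -> (0 < n)%N ->
  (forall j, (0 < j)%N -> cantor_digits Q' x j = E (ap_index m r j)) ->
  occ Q' n B x = hits m m r E B (ap_index m r n).
Proof.
move=> /ap_indexE[r' r'm [rr' apE]] n0 xE.
rewrite /hits (eq_count (a2 := fun p => (p == r' %[mod m]) && occurs_step m E B p));
  last by move=> p; rewrite /= rr'.
rewrite count_mod_iota // apE // ap_count_index // prednK //.
rewrite /occ -[X in iota X _]addn0 iotaDl count_map; apply: eq_count => j /=.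
rewrite occurs_at_step; apply/occurs_stepP/occurs_stepP => EB i /EB <-;
  rewrite xE // apE // muln1; congr (E _); rewrite add1n addSn /= mulnDl; lia.
Qed.

Lemma expected_Lambda_weight Q n m r k : (r < m)%N -> (0 < n)%N ->
  expected (Lambda Q m r) k n = weight m m r k Q (ap_index m r n).
Proof.
move=> /ap_indexE[r' r'm [rr' apE]] n0.
rewrite /weight (eq_bigl (fun p => p == r' %[mod m])); last by move=> p; rewrite rr'.
rewrite -big_filter filter_mod_iota // apE // ap_count_index // prednK //.
rewrite big_map /expected /index_iota subn1 /= -[X in iota X _]addn0 iotaDl big_map.
apply: eq_bigr => j _; congr (_^-1); rewrite -{1}[(1 + j)%N]add0n big_addn addKn.
apply: eq_bigr => i _; rewrite /Lambda /= apE; last lia.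
by congr (Q _)%:R; rewrite add1n addnS /= mulnDl; lia.
Qed.

Lemma hits_inc d m r E B n :
  0 <= ((hits d m r E B n.+1)%:R - (hits d m r E B n)%:R : R) <= 1.
Proof.
rewrite /hits -[n.+1]addn1 iotaD count_cat natrD addrAC subrr add0r /= addn0.
by rewrite ler0n lern1 leq_b1.
Qed.

Lemma hits0 d m r E B : hits d m r E B 0 = 0%N. Proof. by []. Qed.

Lemma weight0 d m r k Q : weight d m r k Q 0 = 0.
Proof. by rewrite /weight big_nil. Qed.

Lemma weight_inc d m r k Q n : (forall p, (1 <= p)%N -> (1 <= Q p)%N) ->
  0 <= weight d m r k Q n.+1 - weight d m r k Q n <= 1.
Proof.
move=> Q1; rewrite /weight -[n.+1]addn1 iotaD big_cat /= addrAC subrr add0r.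
rewrite big_cons big_nil addr0; case: ifP => _; last by rewrite lexx ler01.
rewrite invr_ge0 prodr_ge0 //= invf_le1.
  by rewrite -natr_prod ler1n prodn_gt0 // => j; apply: Q1; lia.
by rewrite -natr_prod ltr0n prodn_gt0 // => j; apply: Q1; lia.
Qed.

Lemma ap_count_bounds n m r : (0 < r <= m)%N ->
  (n%:R / m%:R - 1 : R) <= ((ap_count n m r)%:R : R) <= (n%:R / m%:R + 1 : R).
Proof.
move=> rm; have m0 : 0 < m%:R :> R by rewrite ltr0n; lia.
rewrite lerBlDr ler_pdivrMr // -[X in _ <= _ + X](divff (lt0r_neq0 m0)) -mulrDl.
rewrite ler_pdivlMr // natr1 -natrM -natrM -natrD !ler_nat /ap_count.
by have := divn_eq (n + m - r) m; have := ltn_pmod (n + m - r) (d := m); lia.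
Qed.

(** The positions of a copy that starts after [s] are renumbered from 1, which
    moves the residue class. *)
Lemma residue_shift s r m : (0 < m)%N -> exists2 r', (0 < r' <= m)%N &
  forall p, (s + p == r %[mod m]) = (p == r' %[mod m]).
Proof.
move=> m0; pose q := ((r + (m - s %% m)) %% m)%N.
have qm : (q < m)%N by rewrite ltn_mod.
have sq : s + q = r %[mod m].
  rewrite modnDmr -modnDml addnC -addnA subnK; last by rewrite ltnW // ltn_mod.
  by rewrite modnDr.
exists (if q == 0%N then m else q) => [|p]; first by case: eqP; lia.
rewrite -sq eqn_modDl; have [->|//] := eqVneq q 0%N.
by rewrite modnn mod0n.
Qed.

Lemma iota_shift s n : iota s.+1 n = [seq (s + p)%N | p <- iota 1 n].
Proof. by rewrite -iotaDl addn1. Qed.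

(** Besides the occurrences inside the copy of [Y] there are only those that
    run over its end, and their starting positions are among the last ones. *)
Lemma hits_copy d m r r' s E B Y :
  (forall p, (1 <= p <= size Y)%N -> E (s + p)%N = nth 0%N Y p.-1) ->
  (forall p, (s + p == r %[mod m]) = (p == r' %[mod m])) ->
  exists2 c : nat, (c <= (size B).-1 * d)%N &
    hits d m r E B (s + size Y) = (hits d m r E B s + block_occ_step d m r' B Y + c)%N.
Proof.
move=> EY rr'; rewrite /hits iotaD count_cat add1n (iota_shift s) count_map.
set P := preim _ _; pose F := fits_step d B Y.
exists (count (predI P (predC F)) (iota 1 (size Y))).
  (* Occurrences starting up to [y] fit into the copy. *)
  pose y := (size Y - (size B).-1 * d)%N.
  have yY : (y <= size Y)%N by rewrite leq_subr.
  rewrite -[in iota _ _](subnKC yY) iotaD count_cat.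
  rewrite (@eq_in_count _ _ pred0 (iota 1 y)) ?count_pred0 ?add0n; last first.
    move=> p; rewrite mem_iota /y => py; rewrite /= /F /fits_step.
    by apply/negbTE; rewrite negb_and negbK orbC; apply/orP; left; lia.
  by rewrite (leq_trans (count_size _ _)) // size_iota /y; lia.
rewrite -addnA; congr addn.
have splitF u : count P u = (count (predI P F) u + count (predI P (predC F)) u)%N.
  by elim: u => //= p u ->; case: (P p); case: (F p) => /=; lia.
rewrite splitF; congr addn; rewrite /block_occ_step.
apply: eq_in_count => p.
rewrite mem_iota => /andP[p0 _]; rewrite /P /F /= rr' -andbA; congr (_ && _).
rewrite andbC; apply: andb_id2l => fit; apply/occurs_stepP/occurs_stepP => EB j jB;
  rewrite -EB //= -addnA EY //; move: fit; rewrite /F /fits_step; nia.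
Qed.

(** The summands are at most [b ^ - k], with equality unless the [k] letters reach
    beyond the copy; the number of summands differs from [x / m] by at most 1. *)
Lemma weight_copy d m r r' s b k x Q :
  (0 < r' <= m)%N -> (0 < b)%N ->
  (forall p, (1 <= p <= x)%N -> Q (s + p)%N = b) ->
  (forall p, (s < p)%N -> (b <= Q p)%N) ->
  (forall p, (s + p == r %[mod m]) = (p == r' %[mod m])) ->
  `|weight d m r k Q (s + x) - weight d m r k Q s - (b%:R ^+ k)^-1 * (x%:R / m%:R)|
    <= (k.-1 * d)%:R + 1.
Proof.
move=> r'm b0 Qb Qge rr'.
have m0 : 1 <= m%:R :> R by rewrite ler1n; lia.
pose f p : R := (\prod_(0 <= j < k) (Q (s + p + j * d)%N)%:R)^-1.
(* Up to [y] the [k] letters stay in the copy. *)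
pose y := (x - k.-1 * d)%N.
have yx : (y <= x)%N by rewrite leq_subr.
have -> : weight d m r k Q (s + x) - weight d m r k Q s =
    \sum_(p <- iota 1 x | p == r' %[mod m]) f p.
  rewrite /weight iotaD big_cat /= addrAC subrr add0r add1n (iota_shift s) big_map.
  by apply: eq_bigl => p; rewrite rr'.
have bk : 1 <= b%:R ^+ k :> R by rewrite exprn_ege1 // ler1n.
have bk0 : 0 < (b%:R ^+ k)^-1 :> R by rewrite invr_gt0; lra.
have bk1 : (b%:R ^+ k)^-1 <= 1 :> R by rewrite invf_le1; lra.
have prod_ge p : (0 < p)%N ->
    b%:R ^+ k <= \prod_(0 <= j < k) (Q (s + p + j * d)%N)%:R :> R.
  move=> p0; rewrite -[X in _ ^+ X](subn0 k) -prodr_const_nat.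
  by rewrite -!natr_prod ler_nat; apply: leq_prod => j _; apply: Qge; lia.
have f_le p : (0 < p)%N -> 0 <= f p <= (b%:R ^+ k)^-1.
  move=> p0; rewrite invr_ge0 prodr_ge0 //= lef_pV2 ?prod_ge // posrE; last lra.
  by apply: lt_le_trans (prod_ge _ p0); lra.
have f_eq p : (0 < p <= y)%N -> f p = (b%:R ^+ k)^-1.
  move=> py; congr (_^-1).
  rewrite -[X in _ ^+ X](subn0 k) -prodr_const_nat.
  apply: eq_big_nat => j jk; rewrite -addnA Qb //; move: py; rewrite /y; nia.
have sum_const n : \sum_(p <- iota 1 n | p == r' %[mod m]) (b%:R ^+ k)^-1 =
    (b%:R ^+ k)^-1 * (ap_count n m r')%:R.
  rewrite -big_filter filter_mod_iota // big_map big_const_seq count_predT size_iota.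
  by rewrite iter_addr_0 mulr_natr.
have up : \sum_(p <- iota 1 x | p == r' %[mod m]) f p <=
    (b%:R ^+ k)^-1 * (x%:R / m%:R + 1).
  have /andP[_ cx] := ap_count_bounds x r'm.
  apply: le_trans (_ : _ <= (b%:R ^+ k)^-1 * (ap_count x m r')%:R) _;
    last by rewrite ler_pM2l.
  rewrite -sum_const big_seq_cond [leRHS]big_seq_cond; apply: ler_sum => p.
  by rewrite mem_iota => /andP[/andP[p0 _] _]; case/andP: (f_le p p0).
have lo : (b%:R ^+ k)^-1 * (y%:R / m%:R - 1) <=
    \sum_(p <- iota 1 x | p == r' %[mod m]) f p.
  have /andP[cy _] := ap_count_bounds y r'm.
  apply: le_trans (_ : (b%:R ^+ k)^-1 * (ap_count y m r')%:R <= _);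
    first by rewrite ler_pM2l.
  rewrite -sum_const -[in leRHS](subnKC yx) iotaD big_cat /=.
  have -> : \sum_(p <- iota 1 y | p == r' %[mod m]) (b%:R ^+ k)^-1 =
      \sum_(p <- iota 1 y | p == r' %[mod m]) f p.
    rewrite big_seq_cond [RHS]big_seq_cond; apply: eq_bigr => p /andP[].
    by rewrite mem_iota => py _; rewrite f_eq //; lia.
  rewrite lerDl big_seq_cond sumr_ge0 // => p /andP[]; rewrite mem_iota => py _.
  by have /andP[] := f_le p ltac:(lia).
have yxR : x%:R - (k.-1 * d)%:R <= y%:R :> R.
  by rewrite lerBlDr -natrD ler_nat /y; lia.
have K0 : 0 <= (k.-1 * d)%:R :> R by [].
have mi1 : m%:R^-1 <= 1 :> R by rewrite invf_le1; lra.
have mi0 : 0 < m%:R^-1 :> R by rewrite invr_gt0; lra.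
move: (_^-1) bk0 bk1 up lo mi0 mi1 => t t0 t1.
move: (m%:R^-1) => u up lo u0 u1.
have yu : (x%:R - (k.-1 * d)%:R) * u <= y%:R * u by rewrite ler_pM2r.
have Ku : (k.-1 * d)%:R * u <= (k.-1 * d)%:R by rewrite ler_piMr // ltW.
rewrite ler_norml; apply/andP; split; nra.
Qed.
End HitsAndWeights.

(** * Levels and digits of the construction *)

Section LevelsAndDigits.
Context {R : realType} (D : apbff R) (X : nat -> seq nat).
Local Notation L := (L D X).
Local Notation level := (level D X).
Local Notation Gamma := (Gamma D X).
Local Notation digit := (digit D X).

Lemma L0 : L 0 = 0%N. Proof. by rewrite /Defs.L big_geq. Qed.

Lemma LS i : L i.+1 = (L i + l_ D i.+1 * size (X i.+1))%N.
Proof. by rewrite /Defs.L big_nat_recr. Qed.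

Lemma leq_L i j : (i <= j)%N -> (L i <= L j)%N.
Proof.
move=> /subnKC <-; elim: (j - i)%N => [|d IH]; first by rewrite addn0.
by rewrite addnS LS (leq_trans IH) ?leq_addr.
Qed.

Lemma L_unbounded :
  (\forall i \near \oo, (0 < l_ D i)%N) -> (\forall i \near \oo, (0 < size (X i))%N) ->
  forall n, exists i, (n <= L i)%N.
Proof.
move=> [N1 _ l0] [N2 _ X0]; elim=> [|n [i ni]]; first by exists 0%N.
pose j := maxn i (maxn N1 N2); exists j.+1; rewrite LS.
have ij : (L i <= L j)%N by apply: leq_L; exact: leq_maxl.
have lj : (0 < l_ D j.+1)%N by apply: l0 => /=; rewrite /j; lia.
have Xj : (0 < size (X j.+1))%N by apply: X0 => /=; rewrite /j; lia.
by have : (0 < l_ D j.+1 * size (X j.+1))%N; rewrite ?muln_gt0 ?lj //; lia.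
Qed.

Lemma level_eq i n : (L i < n <= L i.+1)%N -> level n = i.+1.
Proof.
move=> /andP[Li iL]; rewrite /Defs.level.
case: xgetP => [j _ [j1 /andP[Lj jL]]|/(_ i.+1)]; last by case; rewrite /= Li iL.
apply/eqP; rewrite eqn_leq; apply/andP; split; rewrite leqNgt; apply/negP => lt.
  by have := @leq_L i.+1 j.-1 ltac:(lia); lia.
by have := @leq_L j i ltac:(lia); lia.
Qed.

Lemma concatS i : concat D X i.+1 =
  concat D X i ++ flatten (nseq (l_ D i.+1) (X i.+1)).
Proof.
by rewrite /concat -[i.+1]addn1 iotaD map_cat flatten_cat /= cats0 add1n addn1.
Qed.

Lemma size_concat i : size (concat D X i) = L i.
Proof.
elim: i => [|i IH]; first by rewrite L0.
rewrite concatS size_cat IH LS; congr addn.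
by elim: (l_ D i.+1) => //= l IHl; rewrite size_cat IHl mulSn.
Qed.

Lemma nth_flatten_nseq (Y : seq nat) l a p : (a < l)%N -> (p < size Y)%N ->
  nth 0%N (flatten (nseq l Y)) (a * size Y + p) = nth 0%N Y p.
Proof.
elim: l a => // l IH [|a] al pY /=; rewrite nth_cat; first by rewrite add0n pY.
by rewrite ltnNge mulSn -addnA leq_addr /= addKn IH.
Qed.

Lemma copy_position i a p : (a < l_ D i.+1)%N -> (0 < p <= size (X i.+1))%N ->
  (L i < L i + a * size (X i.+1) + p <= L i.+1)%N.
Proof. move=> al pX; rewrite LS; nia. Qed.

Lemma Gamma_copy i a p : (a < l_ D i.+1)%N -> (0 < p <= size (X i.+1))%N ->
  Gamma (L i + a * size (X i.+1) + p) = b_ D i.+1.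
Proof. by move=> al pX; rewrite /Defs.Gamma (level_eq (copy_position al pX)). Qed.

Lemma digit_copy i a p : (a < l_ D i.+1)%N -> (0 < p <= size (X i.+1))%N ->
  digit (L i + a * size (X i.+1) + p) = nth 0%N (X i.+1) p.-1.
Proof.
move=> al pX; rewrite /Defs.digit (level_eq (copy_position al pX)) concatS.
rewrite nth_cat size_concat.
have -> : (L i + a * size (X i.+1) + p).-1 = (L i + (a * size (X i.+1) + p.-1))%N.
  by lia.
by rewrite ltnNge leq_addr /= addKn nth_flatten_nseq //; lia.
Qed.

Hypothesis Lub : forall n, exists i, (n <= L i)%N.

Lemma level_ex n : (0 < n)%N -> exists i, (L i < n <= L i.+1)%N.
Proof.
move=> n0; have [[|i] nL minL] := ex_minnP (Lub n); first by rewrite L0 in nL; lia.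
exists i; rewrite nL andbT ltnNge; apply/negP => /minL; rewrite ltnn //.
Qed.

Lemma position_ex n : (0 < n)%N -> exists i a p,
  [/\ (a < l_ D i.+1)%N, (0 < p <= size (X i.+1))%N
    & n = (L i + a * size (X i.+1) + p)%N].
Proof.
move=> /level_ex[i /andP[Ln]]; rewrite LS => nL.
have X0 : (0 < size (X i.+1))%N by nia.
exists i, ((n - L i).-1 %/ size (X i.+1))%N, ((n - L i).-1 %% size (X i.+1)).+1.
have dE := divn_eq (n - L i).-1 (size (X i.+1)).
split; [|by rewrite ltn_mod|by lia].
by rewrite ltn_divLR //; lia.
Qed.

Lemma Gamma_ge2 n : (0 < n)%N -> (2 <= Gamma n)%N.
Proof. by move=> /position_ex[i [a [p [al pX ->]]]]; rewrite Gamma_copy // b_ge2. Qed.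

Lemma leq_b i j : (i <= j)%N -> (b_ D i.+1 <= b_ D j.+1)%N.
Proof.
move=> /subnKC <-; elim: (j - i)%N => [|d IH]; first by rewrite addn0.
by rewrite addnS (leq_trans IH) //; exact: b_ndecr.
Qed.

Lemma Gamma_ge i n : (L i < n)%N -> (b_ D i.+1 <= Gamma n)%N.
Proof.
move=> Ln; have [j /andP[Lj jL]] := level_ex (leq_ltn_trans (leq0n _) Ln).
have ij : (i <= j)%N.
  by rewrite leqNgt; apply/negP => ji; have := leq_L ji; lia.
by rewrite /Defs.Gamma (level_eq (i := j)) ?leq_b // Lj.
Qed.

Lemma digit_is_digits :
  (forall i, (1 <= i)%N -> all (fun d => d < b_ D i)%N (X i)) ->
  is_digits Gamma digit.
Proof.
move=> Xb n /position_ex[i [a [p [al pX ->]]]].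
rewrite Gamma_copy // digit_copy //; apply: (allP (Xb i.+1 isT)).
by case/andP: pX => p0 pX; rewrite mem_nth // prednK.
Qed.
End LevelsAndDigits.

(** * Copies of a normal block *)

(** In the application [t = b ^ - k], [q - r] is the quotient whose ceiling is [z],
    and [N] is a count that normality bounds; replacing [z] by [q]
    costs at most 1 in the main term and at most 1 in the relative error. *)
Lemma normal_count_close {R : realType} (t q z r eps e N : R) :
  0 < t <= 1 -> 0 <= q -> 0 < r <= 1 -> (z - 1 < q - r <= z) ->
  `|eps| <= e -> e <= 1 -> t * z * (1 - eps) <= N <= t * z * (1 + eps) ->
  `|N - t * q| <= e * (t * q) + 2.
Proof.
move=> /andP[t0 t1] q0 /andP[r0 r1] /andP[z1 z2] epse e1 /andP[N1 N2].
have zq : `|z| <= q + 1 by rewrite ler_norml; apply/andP; split; lra.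
have zt : `|z - q| <= 1 by rewrite ler_norml; apply/andP; split; lra.
have e0 : 0 <= e by apply: le_trans epse.
have h1 : `|N - t * z| <= e * (t * q) + 1.
  apply: (@le_trans _ _ (t * `|z| * `|eps|)).
    have : `|t * z * eps| = t * `|z| * `|eps| by rewrite !normrM (gtr0_norm t0).
    move=> <-; rewrite ler_norml; have := ler_norm (t * z * eps).
    by rewrite lerNl; move=> ?; apply/andP; split; lra.
  apply: (@le_trans _ _ (t * (q + 1) * e)).
    by apply: ler_pM => //; [rewrite mulr_ge0 // ltW | rewrite ler_pM2l].
  have : t * e <= 1 by rewrite mulr_ile1 // ltW.
  lra.
have h2 : `|t * z - t * q| <= 1.
  by rewrite -mulrBr normrM (gtr0_norm t0) mulr_ile1 // ltW.
have -> : N - t * q = (N - t * z) + (t * z - t * q) by lra.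
by apply: le_trans (ler_normD _ _) _; lra.
Qed.

Section NormalCopies.
Context {R : realType} (D : apbff R) (X : nat -> seq nat) (d m k : nat).

(** The common form of normality of type I ([d = 1]) and of type II ([d = m]) of
    the blocks, for one order [k] and one modulus [m] that they eventually
    reach. *)
Definition step_normal : Prop :=
  \forall i \near \oo, forall B (r : nat), size B = k -> (0 < r <= m)%N ->
    let c : R := (Num.ceil (((size (X i))%:R - r%:R) / m%:R : R))%:~R in
    block_measure (mu_ D i) B * c * (1 - eps_ D i)
      <= (block_occ_step d m r B (X i))%:R
      <= block_measure (mu_ D i) B * c * (1 + eps_ D i).

Hypotheses (k0 : (0 < k)%N) (m0 : (0 < m)%N).
Hypothesis l0 : \forall i \near \oo, (0 < l_ D i)%N.
Hypothesis Xlarge :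
  (fun i => (b_ D i)%:R ^+ k / (eps_ D i.-1 - eps_ D i) : R)
    =o_\oo (fun i => (size (X i))%:R : R).
Hypothesis Xnext :
  (fun i => (l_ D i)%:R^-1 * ((size (X i.+1))%:R / (size (X i))%:R) : R)
    =o_\oo (fun i => ((b_ D i)%:R ^+ k)^-1 : R).
Hypothesis Xnormal : step_normal.

(** The main term, for one copy of [X i], both of the number of occurrences of a
    block of length [k] in a residue class and of the normalising sum. *)
Definition expected_in_copy i : R :=
  ((b_ D i)%:R ^+ k)^-1 * ((size (X i))%:R / m%:R).
Local Notation g := expected_in_copy.

Let mR0 : 0 < m%:R :> R. Proof. by rewrite ltr0n. Qed.

Lemma bk_ge1 i : (1 <= i)%N -> 1 <= (b_ D i)%:R ^+ k :> R.
Proof. by move=> i1; rewrite exprn_ege1 // ler1n ltnW // b_ge2. Qed.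

(** The differences of the [eps] tend to 0, so already [b_i ^ k = o(|X_i|)]. *)
Lemma expected_in_copy_infty : g @ \oo --> +oo.
Proof.
apply/cvgryPge => A; pose C := Num.max A 1.
have C1 : 1 <= C by rewrite le_max lexx orbT.
have CA : A <= C by rewrite le_max lexx.
have C0 : 0 < (C * m%:R)^-1 by rewrite invr_gt0 mulr_gt0 //; lra.
have [N1 HN1] := near_infty_ex ((eqoP _ _ _).1 Xlarge _ C0).
have half0 : 0 < 1 / 2 :> R by lra.
have /near_infty_ex[N2 HN2] : \forall i \near \oo, `|eps_ D i| <= 1 / 2.
  by move/cvgr0Pnorm_le: (@eps_cvg0 _ D); apply.
exists (maxn N1 N2).+2 => // i /= iN; have [iN1 iN2 iN3 i1] :
    [/\ (N1 <= i)%N, (N2 <= i)%N, (N2 <= i.-1)%N & (1 <= i.-1)%N].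
  by split; lia.
have ip : i.-1.+1 = i by lia.
have e1 := HN2 _ iN2; have e2 := HN2 _ iN3.
have e3 : eps_ D i < eps_ D i.-1.
  by have := eps_decr D i1; rewrite ip.
have bk : 1 <= (b_ D i)%:R ^+ k :> R by rewrite -ip bk_ge1.
move: e1 e2; rewrite !ler_norml => /andP[? ?] /andP[? ?].
set t := eps_ D i.-1 - eps_ D i.
have t0 : 0 < t by rewrite /t; lra.
have t1 : t <= 1 by rewrite /t; lra.
have bt0 : 0 <= (b_ D i)%:R ^+ k / t by apply: divr_ge0; [lra|exact: ltW].
have := HN1 i iN1; rewrite (ger0_norm bt0) (ger0_norm (ler0n _ _)).
rewrite ler_pdivrMr // mulrAC -mulrA => H.
have {}H : (b_ D i)%:R ^+ k * (C * m%:R) <= (size (X i))%:R.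
  rewrite -ler_pdivlMr ?mulr_gt0 //; last lra.
  apply: le_trans H _; rewrite mulrC ler_pM2r // ler_piMl //.
apply: le_trans CA _; rewrite /g ler_pdivlMl; last lra.
by rewrite ler_pdivlMr // -mulrA.
Qed.

Lemma copies_unbounded n : exists i, (n <= L D X i)%N.
Proof.
apply: L_unbounded => //.
have /near_infty_ex[N HN] : \forall i \near \oo, 1 <= g i.
  by move/cvgryPge: expected_in_copy_infty; apply.
exists N => // i /= /HN; rewrite /g lt0n; apply: contraTneq => ->.
by rewrite mul0r mulr0 ler10.
Qed.

(** Once [v i] exceeds the letters of [B], uniformity gives its measure. *)
Lemma block_measure_uniform B : size B = k ->
  \forall i \near \oo, block_measure (mu_ D i) B = ((b_ D i)%:R ^+ k)^-1.
Proof.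
move=> Bk; pose M := (\max_(a <- B) a).+1.
have /near_infty_ex[N HN] : \forall i \near \oo, (M <= v_ D i)%N.
  by move/cvgnyPge: (@v_infty _ D); apply.
exists (maxn N 1) => // i /= iN.
have [_ HB] := mu_uniform D (i := i) ltac:(lia).
rewrite HB ?Bk //; apply/allP => a aB.
apply: leq_trans (HN i _); last lia.
by rewrite /M ltnS; apply: (@leq_bigmax_seq _ _ xpredT id).
Qed.

Local Notation Gamma := (Gamma D X).
Local Notation digit := (digit D X).

(** The absolute errors (letters at the end of the copy and rounding) are bounded
    by the constant [K], and hence negligible against [g]; the only relative
    error is [eps]. *)
Lemma copy_estimates B r e : size B = k -> 0 < e ->
  \forall i \near \oo, forall a, (a < l_ D i.+1)%N ->
    let s := (L D X i + a * size (X i.+1))%N in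
    let A n := (hits d m r digit B n)%:R : R in
    let W n := weight d m r k Gamma n : R in
    `|A (s + size (X i.+1))%N - A s - g i.+1| <= e * g i.+1 /\
    `|W (s + size (X i.+1))%N - W s - g i.+1| <= e * g i.+1.
Proof.
move=> Bk e0; pose K : R := (k.-1 * d)%:R + 2.
pose e' := Num.min (e / 2) 1.
have e'0 : 0 < e' by rewrite lt_min ltr01 andbT; lra.
have e'e : e' <= e / 2 by rewrite ge_min lexx.
have e'1 : e' <= 1 by rewrite ge_min lexx orbT.
have /near_infty_ex[N1 HN1] : \forall i \near \oo, `|eps_ D i| <= e'.
  by move/cvgr0Pnorm_le: (@eps_cvg0 _ D); apply.
have /near_infty_ex[N2 HN2] : \forall i \near \oo, K / (e / 2) <= g i.
  by move/cvgryPge: expected_in_copy_infty; apply.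
have /near_infty_ex[N3 HN3] := block_measure_uniform Bk.
have /near_infty_ex[N4 HN4] := Xnormal.
exists (maxn (maxn N1 N2) (maxn N3 N4)) => // i /= iN a al.
set s := (L D X i + a * size (X i.+1))%N.
have [iN1 iN2 iN3 iN4] :
    [/\ (N1 <= i.+1)%N, (N2 <= i.+1)%N, (N3 <= i.+1)%N & (N4 <= i.+1)%N].
  by split; lia.
have [eps gK muB Xn] := And4 (HN1 _ iN1) (HN2 _ iN2) (HN3 _ iN3) (HN4 _ iN4).
have bk := bk_ge1 (i := i.+1) isT.
have Kg : K <= e / 2 * g i.+1.
  by rewrite mulrC -ler_pdivrMr //; lra.
have g0 : 0 <= g i.+1 by rewrite mulr_ge0 ?divr_ge0 // invr_ge0; lra.
have eg : 0 <= e / 2 * g i.+1 by rewrite mulr_ge0 // ltW // divr_gt0.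
have [r' r'm rr'] := residue_shift s r m0.
split; last first.
  have b0 : (0 < b_ D i.+1)%N by rewrite ltnW // b_ge2.
  have := @weight_copy R d m r r' s (b_ D i.+1) k (size (X i.+1)) Gamma r'm b0 _ _ rr'.
  move=> /(_ _ _)/le_trans; apply.
  - by move=> p pX; rewrite Gamma_copy.
  - move=> p sp; apply: (Gamma_ge copies_unbounded).
    exact: leq_ltn_trans (leq_addr _ _) sp.
  - by move: Kg; rewrite /K; lra.
have [c ck ->] := @hits_copy d m r r' s digit B (X i.+1)
  (fun p pX => digit_copy al pX) rr'.
have {ck} ck : c%:R <= (k.-1 * d)%:R :> R by rewrite ler_nat -Bk.
have := Xn B r' Bk r'm; rewrite muB /= mulrBl.
set q := (size (X i.+1))%:R / m%:R; set z := (Num.ceil _)%:~R => HN.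
have close : `|(block_occ_step d m r' B (X i.+1))%:R - g i.+1| <= e' * g i.+1 + 2.
  apply: (normal_count_close (r := r'%:R / m%:R) _ _ _ _ eps e'1 HN).
  - by rewrite invr_gt0 invf_le1; lra.
  - by rewrite divr_ge0.
  - by case/andP: r'm => r'0 r'1; rewrite divr_gt0 ?ltr0n ?ler_pdivrMr ?mul1r ?ler_nat.
  - by have := ceil_itv (q - r'%:R / m%:R); rewrite intrB.
have e'g : e' * g i.+1 <= e / 2 * g i.+1 by rewrite ler_wpM2r.
have c0 : 0 <= c%:R :> R by [].
have regroup (h u v w : R) : h + u + v - h - w = (u - w) + v by ring.
rewrite !natrD regroup.
apply: le_trans (ler_normD _ _) _; rewrite (ger0_norm c0).
by move: Kg; rewrite /K; lra.
Qed.

Lemma next_copy_small e : 0 < e ->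
  \forall i \near \oo, (size (X i.+1))%:R <= e * ((l_ D i)%:R * g i).
Proof.
move=> e0; have em0 : 0 < e / m%:R by rewrite divr_gt0.
have /near_infty_ex[N1 HN1] := (eqoP _ _ _).1 Xnext _ em0.
have /near_infty_ex[N2 HN2] := l0.
have /near_infty_ex[N3 HN3] : \forall i \near \oo, 1 <= g i.
  by move/cvgryPge: expected_in_copy_infty; apply.
exists (maxn N1 (maxn N2 N3)).+1 => // i /= iN.
have [iN1 iN2 iN3 i1] : [/\ (N1 <= i)%N, (N2 <= i)%N, (N3 <= i)%N & (1 <= i)%N].
  by split; lia.
have l1 : 0 < (l_ D i)%:R :> R by rewrite ltr0n; exact: HN2.
have bk := bk_ge1 i1.
have X1 : 0 < (size (X i))%:R :> R.
  rewrite ltr0n lt0n; have := HN3 i iN3.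
  by rewrite /g; apply: contraTneq => ->; rewrite mul0r mulr0 ler10.
have := HN1 i iN1; rewrite /= !ger0_norm ?invr_ge0 ?mulr_ge0 ?divr_ge0 //;
  try lra.
rewrite ler_pdivrMl // ler_pdivrMr // => H; apply: le_trans H _.
by rewrite le_eqVlt; apply/orP; left; apply/eqP; rewrite /g; ring.
Qed.

(** The asymptotic equality that both types of normality consist of. *)
Lemma hits_weight_ratio B r : size B = k ->
  (hits d m r digit B n)%:R / weight d m r k Gamma n @[n --> \oo] --> (1 : R).
Proof.
move=> Bk; apply: (@block_sums_ratio_cvg1 R
  (fun n => (hits d m r digit B n)%:R) (weight d m r k Gamma)
  (fun i => size (X i)) (l_ D) (L D X) g).
- by rewrite hits0.
- exact: weight0.
- exact: hits_inc.
- by move=> n; apply: weight_inc => p p1; exact: ltnW (Gamma_ge2 copies_unbounded p1).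
- exact: LS.
- exact: copies_unbounded.
- exact: l0.
- exact: expected_in_copy_infty.
- by move=> e e0; exact: copy_estimates.
- exact: next_copy_small.
Qed.

(** Every late copy contains the block of [k] zeros in each residue class. *)
Lemma digit_zero_infinitely_often r N :
  exists p, [/\ (N <= p)%N, p = r %[mod m] & digit p = 0%N].
Proof.
have half0 : 0 < 1 / 2 :> R by lra.
have /near_infty_ex[N1 HN1] := copy_estimates r (size_nseq k 0%N) half0.
have /near_infty_ex[N2 HN2] : \forall i \near \oo, 1 <= g i.
  by move/cvgryPge: expected_in_copy_infty; apply.
have /near_infty_ex[N3 HN3] := l0.
have [j jN] := copies_unbounded N.
pose i := maxn (maxn N1 N2) (maxn N3 j).
have [iN1 iN2 iN3 ij] : [/\ (N1 <= i)%N, (N2 <= i.+1)%N, (N3 <= i.+1)%N & (j <= i)%N].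
  by rewrite /i; split; lia.
have := HN1 i iN1 0%N (HN3 _ iN3).
rewrite /= mul0n addn0 => -[+ _]; have gi := HN2 _ iN2.
rewrite ler_norml => /andP[H _].
have {H} : (hits d m r digit (nseq k 0%N) (L D X i) <
            hits d m r digit (nseq k 0%N) (L D X i + size (X i.+1)))%N.
  by rewrite -(ltr_nat R); lra.
rewrite /hits iotaD count_cat -[X in (X < _)%N]addn0 ltn_add2l -has_count.
case/hasP => p; rewrite mem_iota => pL /andP[/eqP pr /occurs_stepP /(_ 0%N)].
rewrite size_nseq mul0n addn0 nth_nseq k0 => /(_ isT) p0.
exists p; split => //; have /andP[Lp _] := pL.
by rewrite (leq_trans jN) // (leq_trans (leq_L D X ij)) // ltnW // -add1n.
Qed.

End NormalCopies.

(** * Normality of eta *)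

Section Assembly.
Context {R : realType}.
Implicit Types (D : apbff R) (X : nat -> seq nat).

(** Integers below [q] are at most [q - 1], so a limit of at least [q] is only
    possible if some term reaches [q]. *)
Lemma nondecreasing_lim_ge (u : nat -> int) (q : int) :
  nondecreasing_from1 u ->
  (q%:~R%:E <= limn (fun i => (u i)%:~R%:E : \bar R))%E ->
  \forall i \near \oo, q <= u i.
Proof.
move=> u_ndecr qlim.
have u_le i j : (i <= j)%N -> u i.+1 <= u j.+1.
  move=> /subnKC <-; elim: (j - i)%N => [|d IH]; first by rewrite addn0.
  by rewrite addnS (le_trans IH) //; exact: u_ndecr.
have [[i qi]|no] := pselect (exists i, q <= u i.+1).
  by exists i.+1 => // -[//|j] /= ij; apply: (le_trans qi); exact: u_le.
have lt i : u i.+1 <= q - 1.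
  by rewrite -ltzD1 subrK ltNge; apply/negP => qu; apply: no; exists i.
suff : (limn (fun i => (u i)%:~R%:E : \bar R) <= (q - 1)%:~R%:E)%E.
  by move=> /(le_trans qlim); rewrite lee_fin ler_int; lia.
have cv : cvgn (fun i => (u i.+1)%:~R%:E : \bar R).
  apply: ereal_nondecreasing_is_cvgn => i j ij.
  by rewrite lee_fin ler_int; exact: u_le.
have cv' : cvgn (fun i => (u i)%:~R%:E : \bar R).
  case/cvg_ex: cv => l ul; apply/cvg_ex; exists l => /=.
  by rewrite -cvg_shiftS; exact: ul.
apply: lime_le => //; exists 1%N => // -[//|i] _ /=.
by rewrite lee_fin ler_int; exact: lt.
Qed.

Lemma RD_eventually D k : RD D k -> \forall i \near \oo, (k <= k_ D i)%N.
Proof.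
move=> [_ klim].
by have := @nondecreasing_lim_ge (fun i => Posz (k_ D i)) k (@k_ndecr _ D) klim.
Qed.

Lemma SD_eventually D m : SD D m -> \forall i \near \oo, m%:Z <= m_ D i.
Proof.
by move=> [_ mlim]; exact: (@nondecreasing_lim_ge (m_ D) m (@m_ndecr _ D) mlim).
Qed.

Lemma RD_infty D k : (1 <= k)%N -> k_ D @ \oo --> \oo -> RD D k.
Proof.
move=> k1 /cvgnyPge koo; split=> //.
rewrite (_ : limn _ = +oo%E) ?leey //; apply/cvg_lim => //.
apply/cvgeyPge => A; near=> i; rewrite lee_fin.
apply: le_trans (_ : (Num.bound `|A|)%:R <= _).
  by apply: le_trans (ler_norm _) _; rewrite ltW // archi_boundP.
by rewrite ler_nat; near: i; exact: koo.
Unshelve. all: by end_near. Qed.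

Lemma SD_infty D m : (1 <= m)%N ->
  (m_ D i)%:~R @[i --> \oo] --> (+oo : set_system R) -> SD D m.
Proof.
move=> m1 /cvgryPge moo; split=> //.
rewrite (_ : limn _ = +oo%E) ?leey //; apply/cvg_lim => //.
by apply/cvgeyPge => A; near=> i; rewrite lee_fin; near: i; exact: moo.
Unshelve. all: by end_near. Qed.

Lemma goodI_step_normal D X k m : goodI D X -> RD D k -> SD D m ->
  step_normal D X 1 m k.
Proof.
move=> [_ _ Xn _] kR mS.
have [/near_infty_ex[N1 HN1] /near_infty_ex[N2 HN2]] :=
  (RD_eventually kR, SD_eventually mS).
exists (maxn 1 (maxn N1 N2)) => // i /= iN B r Bk rm.
have := Xn i ltac:(lia) B m r _ (HN2 i ltac:(lia)) rm.
rewrite block_occ_ap_step ?Bk; last by case: kR.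
by apply; rewrite HN1 ?andbT; [case: kR | lia].
Qed.

Lemma goodII_step_normal D X k m : goodII D X -> RD D k -> SD D m ->
  step_normal D X m m k.
Proof.
move=> [_ _ Xn _] kR mS.
have [/near_infty_ex[N1 HN1] /near_infty_ex[N2 HN2]] :=
  (RD_eventually kR, SD_eventually mS).
exists (maxn 1 (maxn N1 N2)) => // i /= iN B r Bk rm.
have := Xn i ltac:(lia) B m r _ (HN2 i ltac:(lia)) rm.
rewrite block_occ_sub_step ?Bk //; last by case: kR.
by apply; rewrite HN1 ?andbT; [case: kR | lia].
Qed.

Section FixedOrder.
Variables (D : apbff R) (X : nat -> seq nat) (d m k : nat).
Hypotheses (kR : RD D k) (mS : SD D m).
Hypothesis Xb : forall i, (1 <= i)%N -> all (fun a => a < b_ D i)%N (X i).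
Hypothesis growth : good_growth D X.
Hypothesis Xnormal : step_normal D X d m k.
Local Notation Gamma := (Gamma D X).
Local Notation digit := (digit D X).
Local Notation eta := (eta D X).

Let k0 : (0 < k)%N. Proof. by case: kR. Qed.
Let m0 : (0 < m)%N. Proof. by case: mS. Qed.

Lemma good_copies_unbounded n : exists i, (n <= L D X i)%N.
Proof.
have [l0 /(_ k kR)[X1 _ _]] := growth.
exact: (copies_unbounded k0 m0 l0 X1).
Qed.

Lemma good_hits_ratio B r : size B = k ->
  (hits d m r digit B n)%:R / weight d m r k Gamma n @[n --> \oo] --> (1 : R).
Proof.
have [l0 /(_ k kR)[X1 _ X3]] := growth.
exact: (hits_weight_ratio k0 m0 l0 X1 X3 Xnormal).
Qed.

Lemma good_digit_zero r N : exists p, [/\ (N <= p)%N, p = r %[mod m] & digit p = 0%N].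
Proof.
have [l0 /(_ k kR)[X1 _ _]] := growth.
exact: (digit_zero_infinitely_often k0 m0 l0 X1 Xnormal).
Qed.

Lemma cantor_digits_eta n : (1 <= n)%N -> cantor_digits Gamma eta n = digit n.
Proof.
apply: cantor_digits_series; first exact: digit_is_digits good_copies_unbounded Xb.
move=> N; have [p [pN _ p0]] := good_digit_zero 0 N.+1.
exists p; first exact: ltnW.
have := Gamma_ge2 good_copies_unbounded (leq_ltn_trans (leq0n _) pN).
by rewrite p0; lia.
Qed.

(** Zeros recur in the residue class of [r], so the subsequence is an admissible
    expansion. *)
Lemma cantor_digits_Upsilon r j : (r < m)%N -> (1 <= j)%N ->
  cantor_digits (Lambda Gamma m r) (Upsilon Gamma m r eta) j =
  digit (ap_index m r j).
Proof.
move=> rm; have [r' r'm [rr' apE]] := ap_indexE rm.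
have ap1 i : (1 <= i)%N -> (1 <= ap_index m r i)%N.
  by move=> i1; case/andP: r'm => r0 _; rewrite apE // (leq_trans r0) ?leq_addr.
move=> j1; rewrite -(cantor_digits_eta (ap1 _ j1)).
apply: (cantor_digits_series (E := cantor_digits Gamma eta \o ap_index m r)) => //.
  move=> i i1 /=; rewrite cantor_digits_eta ?ap1 //.
  exact: digit_is_digits good_copies_unbounded Xb _ (ap1 _ i1).
move=> N; have [p [pN /eqP pr p0]] := good_digit_zero r (r' + N * m).
have r'p : (r' <= p)%N by apply: leq_trans pN; exact: leq_addr.
have : (m %| p - r')%N by rewrite -eqn_mod_dvd // rr'.
case/dvdnP => i pE; have {}pE : p = ap_index m r i.+1 by rewrite apE //=; lia.
exists i.+1.
  by move: pN; rewrite pE apE //= leq_add2l leq_pmul2r //; exact: leqW.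
rewrite /= /Lambda /= cantor_digits_eta ?ap1 // -pE p0.
have : (1 <= p)%N by rewrite pE ap1.
by move/(Gamma_ge2 good_copies_unbounded); lia.
Qed.

End FixedOrder.

Lemma goodI_normalI_km D X k m : goodI D X -> RD D k -> SD D m ->
  normalI_km (Gamma D X) k m (eta D X).
Proof.
move=> gX kR mS r rm B Bk; have Xn := goodI_step_normal gX kR mS.
have [Xb _ _ growth] := gX.
have := good_hits_ratio kR mS growth Xn r Bk.
apply: cvg_trans; apply: near_eq_cvg; apply: nearW => n.
rewrite occ_ap_hits expected_ap_weight; congr (_%:R / _).
by apply: eq_hits => p p1; rewrite (cantor_digits_eta kR mS Xb growth Xn).
Qed.

Lemma goodII_normalII_km D X k m : goodII D X -> RD D k -> SD D m ->
  normalII_km (Gamma D X) k m (eta D X).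
Proof.
move=> gX kR mS r rm B Bk; have Xn := goodII_step_normal gX kR mS.
have [Xb _ _ growth] := gX.
have ratio := good_hits_ratio kR mS growth Xn r Bk.
have ap_oo : ap_index m r @ \oo --> \oo.
  apply/cvgnyPge => A; exists A.+1 => // n /= An; have [r' r'm [_ apE]] := ap_indexE rm.
  by rewrite apE; nia.
have := cvg_comp _ _ ap_oo ratio.
apply: cvg_trans; apply: near_eq_cvg; exists 1%N => // n /= n1.
have {}rm : (r < m)%N := rm; rewrite expected_Lambda_weight //.
rewrite (@occ_Lambda_hits R _ (digit D X) n m r) // => j j1.
exact: (cantor_digits_Upsilon kR mS Xb growth Xn).
Qed.

End Assembly.

Theorem theorem1p7 (R : realType) (D : apbff R) (X : nat -> seq nat) :
  (goodI D X ->
     (\bigcap_(k in RD D) \bigcap_(m in SD D) normalI_km (Gamma D X) k m)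
       (eta D X) /\
     (k_ D @ \oo --> \oo -> (m_ D i)%:~R @[i --> \oo] --> (+oo : set_system R) ->
        normalI (Gamma D X) (eta D X))) /\
  (goodII D X ->
     (\bigcap_(k in RD D) \bigcap_(m in SD D) normalII_km (Gamma D X) k m)
       (eta D X) /\
     (k_ D @ \oo --> \oo -> (m_ D i)%:~R @[i --> \oo] --> (+oo : set_system R) ->
        normalII (Gamma D X) (eta D X))).
Proof.
split=> gX; split=> [k kR m mS|koo moo k k1 m].
- exact: goodI_normalI_km.
- move=> /andP[m1 _].
  by apply: goodI_normalI_km => //; [exact: RD_infty|exact: SD_infty].
- exact: goodII_normalII_km.
- by move=> m1; apply: goodII_normalII_km => //; [exact: RD_infty|exact: SD_infty].
Qed.
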